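(* Let $d\ge 2$ and let $f(z)=\sum_{k} c_k z^k$ be an entire function of $d$ complex variables $z=(z_1,\ldots,z_d)\in\mathbb{C}^d$, the sum being over multi-indices $k=(k_1,\ldots,k_d)$ with $k_j\in\{0,1,2,\ldots\}$, $z^k=\prod_{j=1}^d z_j^{k_j}$, and the series converging for all $z\in\mathbb{C}^d$. For $r=(r_1,\ldots,r_d)$ with $r_j\ge0$ let $M_f(r)=\max_{|z_j|\le r_j,\ j=1,\ldots,d}|f(z)|$, and for $v\in\mathbb{R}^d$ let $\Lambda(v)=\ln M_f(e^{v_1},\ldots,e^{v_d})$. Then for every multi-index $k$, $$|c_k|\le\exp\left(-\Lambda^*(k)\right).$$
   Context: For a function $g$ on $\mathbb{R}^d$, its multivariate Young-Fenchel transform is $g^*(y)=\sup_{x\in\mathbb{R}^d}((x,y)-g(x))$, $y\in\mathbb{R}^d$, where $(x,y)$ is the standard scalar product. Conventions: $\ln 0=-\infty$, $\exp(-\infty)=0$. *)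

(* Defs.v *)
From HB Require Import structures.
From mathcomp Require Import all_boot all_order all_algebra finmap.
From mathcomp Require Import all_classical all_reals all_analysis.
From mathcomp Require Import summability complex.

Set Implicit Arguments.
Unset Strict Implicit.
Unset Printing Implicit Defensive.

Import Order.TTheory GRing.Theory Num.Theory.
Import numFieldNormedType.Exports.

Local Open Scope classical_set_scope.
Local Open Scope ring_scope.

(* The cast to [numFieldType] is what gives R[i] its norm topology. *)
Definition Cplx (R : realType) : numFieldType := R[i].

(* Real-valued modulus; the generic [`|z|] lives in R[i]. *)
Definition modulus (R : realType) (z : Cplx R) : R := Normc.normc z.

Definition multi_index (d : nat) := {ffun 'I_d -> nat}.

Definition monomial (R : realType) (d : nat) (z : 'rV[Cplx R]_d)
    (k : multi_index d) : Cplx R :=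
  \prod_(j < d) z 0 j ^+ k j.

(* f is the sum of the power series with coefficients c, converging on the
   whole of C^d.  A series indexed by multi-indices has no preferred order of
   summation: convergence is that of the net of finite partial sums, i.e.
   unconditional (equivalently, absolute) convergence. *)
Definition entire_sum (R : realType) (d : nat) (c : multi_index d -> Cplx R)
    (f : 'rV[Cplx R]_d -> Cplx R) : Prop :=
  forall z : 'rV[Cplx R]_d,
    partial_sum (fun k => c k * monomial z k) @ totally --> f z.

Definition closed_polydisc (R : realType) (d : nat) (r : 'rV[R]_d) :
    set 'rV[Cplx R]_d :=
  [set z | forall j : 'I_d, modulus (z 0 j) <= r 0 j].

(* The supremum over the polydisc, which for continuous f and r_j >= 0 is a
   maximum by compactness; taken in \bar R so that no default value occurs. *)
Definition max_modulus (R : realType) (d : nat)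
    (f : 'rV[Cplx R]_d -> Cplx R) (r : 'rV[R]_d) : \bar R :=
  ereal_sup [set (modulus (f z))%:E | z in closed_polydisc r].

(* [lne] satisfies lne 0 = -oo. *)
Definition log_max_modulus (R : realType) (d : nat)
    (f : 'rV[Cplx R]_d -> Cplx R) (v : 'rV[R]_d) : \bar R :=
  lne (max_modulus f (map_mx (@expR R) v)).

Definition dotprod (R : realType) (d : nat) (x y : 'rV[R]_d) : R :=
  \sum_(j < d) x 0 j * y 0 j.

Definition young_fenchel (R : realType) (d : nat) (g : 'rV[R]_d -> \bar R)
    (y : 'rV[R]_d) : \bar R :=
  ereal_sup (range (fun x : 'rV[R]_d => ((dotprod x y)%:E - g x)%E)).

Definition multi_index_vec (R : realType) (d : nat) (k : multi_index d) :
    'rV[R]_d :=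
  \row_(j < d) (k j)%:R.

(* Main.v *)
Require Import Defs.
From mathcomp Require Import all_boot all_order all_algebra.
From mathcomp Require Import all_classical all_reals all_analysis.
From mathcomp Require Import finmap cyclic separable cyclotomic.
From mathcomp Require Import summability complex.

Set Implicit Arguments.
Unset Strict Implicit.
Unset Printing Implicit Defensive.

Import Order.TTheory GRing.Theory Num.Theory.
Import numFieldNormedType.Exports.

Local Open Scope classical_set_scope.
Local Open Scope ring_scope.

#[local] Existing Instance totally_filter.

(** By definition of the Young-Fenchel transform, the claim says that
    |c_k| e^(v.k) <= M_f(e^v) for every real vector v: Cauchy's inequality on
    the polydisc of radii e^(v_j) ([coef_le_max_modulus]).  Taking logarithms
    and the supremum over v then gives the theorem; a vanishing c_k is set apart
    because its logarithm is not a real number.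

    Cauchy's inequality is proved with averages over finite grids in place of
    integrals over the torus.  Let w be a primitive N-th root of unity.  The
    average over the N^d points (u_j w^(a_j))_j of the partial sum of f over a
    finite set A of multi-indices, twisted by the unimodular weights
    w^(-(a.k)), keeps exactly the terms c_m u^m with m in A congruent to k
    modulo N in every coordinate ([sum_torus_monomial]).  Two facts turn this
    into the bound ([cauchy_inequality]).
    - For fixed N the grid is finite, so a single A makes the partial sums
      close to f at all grid points, and the average is at most sup |f| up to
      an error.
    - Unconditional convergence at the one point u makes every finite sum of
      terms c_m u^m with m outside some finite A0 small ([summable_tail_small]).
      When N exceeds all the exponents occurring in A0 and in k, a multi-index
      other than k that is congruent to k modulo N lies outside A0; so the
      unwanted terms of the average contribute only an error, and what remains
      is c_k u^k. *)

(** * Roots of unity *)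

Lemma prim_root_exists (C : numClosedFieldType) (N : nat) :
  (0 < N)%N -> exists w : C, N.-primitive_root w.
Proof.
move=> N_gt0; have [rs Drs] := closed_field_poly_normal ('X^N - 1 : {poly C}).
move: Drs; rewrite lead_coefXnsubC // scale1r => Drs.
have Urs : uniq rs.
  by rewrite -separable_prod_XsubC -Drs separable_Xn_sub_1 // pnatr_eq0 -lt0n.
have rs_unity : all N.-unity_root rs.
  by apply/allP=> z z_rs; rewrite /root_of_unity Drs root_prod_XsubC.
have sz_rs : (N <= size rs)%N.
  by rewrite -ltnS -(size_prod_XsubC rs id) -Drs size_XnsubC.
by have /hasP[w _ prim_w] := has_prim_root N_gt0 rs_unity Urs sz_rs; exists w.
Qed.

Lemma norm_prim_root (C : numDomainType) (N : nat) (w : C) :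
  N.-primitive_root w -> `|w| = 1.
Proof.
move=> prim_w; apply/eqP.
rewrite -(@pexpr_eq1 _ _ N) ?(prim_order_gt0 prim_w) //.
by rewrite -normrX (prim_expr_order prim_w) normr1.
Qed.

(** Orthogonality of characters of Z/N: up to regrouping, this is the geometric
    sum of the powers of w^m / w^k, an N-th root of unity which is 1 exactly
    when m and k agree modulo N. *)
Lemma sum_prim_root (F : fieldType) (N : nat) (w : F) (m k : nat) :
  N.-primitive_root w ->
  \sum_(a < N) (w ^+ a) ^+ m / (w ^+ a) ^+ k =
    if m == k %[mod N] then N%:R else 0.
Proof.
move=> prim_w; pose x := w ^+ m / w ^+ k.
have wk_neq0 : w ^+ k != 0.
  by rewrite expf_neq0 // (prim_root_eq0 prim_w) -lt0n (prim_order_gt0 prim_w).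
have -> : \sum_(a < N) (w ^+ a) ^+ m / (w ^+ a) ^+ k = \sum_(a < N) x ^+ a.
  by apply: eq_bigr => a _; rewrite /x exprMn exprVn -!exprM ![(a * _)%N]mulnC.
have xN : x ^+ N = 1.
  rewrite /x exprMn exprVn -!exprM ![(_ * N)%N]mulnC !exprM.
  by rewrite (prim_expr_order prim_w) !expr1n divr1.
have x1 : (x == 1) = (m == k %[mod N]).
  rewrite -(eq_prim_root_expr prim_w) /x -(inj_eq (mulIf wk_neq0)).
  by rewrite divfK // mul1r.
rewrite -x1; have [->|x_neq1] := eqVneq x 1.
  by under eq_bigr do rewrite expr1n; rewrite sumr_const card_ord.
have x1_neq0 : x - 1 != 0 by rewrite subr_eq0.
by apply: (mulfI x1_neq0); rewrite -subrX1 xN subrr mulr0.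
Qed.

(** * Averages over a finite grid of the torus *)

(** The a-th point of the grid of N^d points in the torus through u.  For u = 1
    it is the tuple of N-th roots of unity (w^(a_j))_j, whose k-th monomial is
    the character a |-> w^(a.k) of (Z/N)^d. *)
Definition torus_point (R : realType) (d N : nat) (w : Cplx R)
    (u : 'rV[Cplx R]_d) (a : {ffun 'I_d -> 'I_N}) : 'rV[Cplx R]_d :=
  \row_j (u 0 j * w ^+ a j).

Definition mod_congr (d N : nat) (m k : multi_index d) :=
  [forall j, m j == k j %[mod N]].

Lemma norm_torus_point (R : realType) (d N : nat) (w : Cplx R)
    (u : 'rV[Cplx R]_d) (a : {ffun 'I_d -> 'I_N}) (j : 'I_d) :
  N.-primitive_root w -> `|torus_point w u a 0 j| = `|u 0 j|.
Proof.
by move=> prim_w; rewrite mxE normrM normrX (norm_prim_root prim_w) expr1n mulr1.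
Qed.

Lemma norm_monomial (R : realType) (d : nat) (u : 'rV[Cplx R]_d)
    (m : multi_index d) :
  `|monomial u m| = \prod_j `|u 0 j| ^+ m j.
Proof. by rewrite normr_prod; apply: eq_bigr => j _; rewrite normrX. Qed.

Lemma norm_character (R : realType) (d N : nat) (w : Cplx R)
    (a : {ffun 'I_d -> 'I_N}) (k : multi_index d) :
  N.-primitive_root w -> `|monomial (torus_point w (const_mx 1) a) k| = 1.
Proof.
move=> prim_w; rewrite norm_monomial big1 // => j _.
by rewrite norm_torus_point // mxE normr1 expr1n.
Qed.

(** The grid is a product, so the sum factors into one orthogonality relation
    per coordinate.  This is the discrete analogue of the Cauchy integral that
    extracts the k-th coefficient. *)
Lemma sum_torus_monomial (R : realType) (d N : nat) (w : Cplx R)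
    (u : 'rV[Cplx R]_d) (m k : multi_index d) :
  N.-primitive_root w ->
  \sum_(a : {ffun 'I_d -> 'I_N})
     monomial (torus_point w u a) m /
     monomial (torus_point w (const_mx 1) a) k =
  if mod_congr N m k then (N ^ d)%:R * monomial u m else 0.
Proof.
move=> prim_w.
have -> : \sum_(a : {ffun 'I_d -> 'I_N})
      monomial (torus_point w u a) m /
      monomial (torus_point w (const_mx 1) a) k =
    monomial u m *
    \prod_(j < d) \sum_(b < N) (w ^+ b) ^+ m j / (w ^+ b) ^+ k j.
  rewrite bigA_distr_bigA mulr_sumr; apply: eq_bigr => a _.
  rewrite /monomial -prodfV -!big_split /=; apply: eq_bigr => j _.
  by rewrite !mxE mul1r exprMn mulrA.
under eq_bigr do rewrite sum_prim_root //.
case: ifPn => [/forallP congr|/forallPn[j /negbTE ncongr]].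
  under eq_bigr do rewrite congr.
  by rewrite prodr_const card_ord natrX mulrC.
by rewrite (bigD1 j) //= ncongr mul0r mulr0.
Qed.

(** * Unconditional convergence and Cauchy's inequality *)

Lemma partial_sumE (I : choiceType) (V : zmodType) (x : I -> V) (A : {fset I}) :
  partial_sum x A = \sum_(i <- A) x i.
Proof. by rewrite /partial_sum big_seq_fsetE. Qed.

(** The Cauchy criterion for the net of finite partial sums: the sum over the
    part of A satisfying P is the difference of the partial sums over A and over
    the rest of A, and both of these sets contain A0. *)
Lemma summable_tail_small (K : numFieldType) (I : choiceType) (x : I -> K)
    (l e : K) :
  partial_sum x @ totally --> l -> 0 < e ->
  exists A0 : {fset I}, forall (A : {fset I}) (P : pred I),
    (A0 `<=` A)%fset -> (forall i, i \in A0 -> ~~ P i) ->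
    `|\sum_(i <- A | P i) x i| <= e.
Proof.
move=> xl e_gt0.
have e2_gt0 : 0 < e / 2 by rewrite divr_gt0.
have /cvgrPdist_lt /(_ _ e2_gt0) [A0 _ A0P] := xl.
exists A0 => A P A0A PN.
pose B := [fset i in A | ~~ P i]%fset.
have A0B : (A0 `<=` B)%fset.
  by apply/fsubsetP => i iA0; rewrite !inE (fsubsetP A0A) ?PN.
have -> : \sum_(i <- A | P i) x i = (l - partial_sum x B) - (l - partial_sum x A).
  rewrite opprB addrC addrA subrK !partial_sumE /B -big_fset_condE.
  by rewrite [X in _ = X - _](bigID P) /= addrK.
rewrite (le_trans (ler_normB _ _)) // (splitr e).
by apply: lerD; apply/ltW/A0P.
Qed.

Lemma multi_index_bound (d : nat) (A : {fset multi_index d}) :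
  exists2 N, (0 < N)%N & forall m, m \in A -> forall j, (m j < N)%N.
Proof.
exists (\max_(m <- A) \max_j m j).+1 => // m mA j.
rewrite ltnS (leq_trans (leq_bigmax j)) //.
exact: (@leq_bigmax_seq _ _ xpredT (fun m : multi_index d => \max_j m j)%N).
Qed.

Lemma mod_congr_eq (d N : nat) (m k : multi_index d) :
  (forall j, (m j < N)%N) -> (forall j, (k j < N)%N) ->
  mod_congr N m k = (m == k).
Proof.
move=> mN kN; apply/forallP/eqP => [congr|-> //].
by apply/ffunP => j; have := congr j; rewrite !modn_small // => /eqP.
Qed.

(** The bound M is taken over the torus |z_j| = |u_j|, the distinguished boundary
    of the polydisc, because all the grid points lie on it. *)
Lemma cauchy_inequality (R : realType) (d : nat) (c : multi_index d -> Cplx R)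
    (f : 'rV[Cplx R]_d -> Cplx R) (u : 'rV[Cplx R]_d) (M : Cplx R)
    (k : multi_index d) :
  entire_sum c f ->
  (forall z : 'rV[Cplx R]_d, (forall j, `|z 0 j| = `|u 0 j|) -> `|f z| <= M) ->
  `|c k * monomial u k| <= M.
Proof.
move=> hf fM; apply/ler_addgt0Pr => e e_gt0.
have e2_gt0 : 0 < e / 2 by rewrite divr_gt0.
have [A0 A0P] := summable_tail_small (hf u) e2_gt0.
(* With N above all exponents in A0 and k, reduction modulo N is injective on
   these multi-indices. *)
have [N N_gt0 NP] := multi_index_bound (k |` A0)%fset.
have [w prim_w] := prim_root_exists (Cplx R) N_gt0.
pose z := torus_point (N := N) w u.
pose chi := fun a => monomial (torus_point (N := N) w (const_mx 1) a) k.
pose P := fun A v => partial_sum (fun m => c m * monomial v m) A.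
(* N, hence the grid, is fixed before A is chosen: pointwise convergence at
   finitely many points suffices. *)
have : \forall A \near totally,
    (k |` A0 `<=` A)%fset /\ forall a, `|f (z a) - P A (z a)| < e / 2.
  near=> A; split; first by near: A; exists (k |` A0)%fset.
  near: A; apply: filter_forall => a.
  by have /cvgrPdist_lt /(_ _ e2_gt0) := hf (z a).
move=> /filter_ex[A [kA0A PA]].
have kA : k \in A by rewrite (fsubsetP kA0A) ?fset1U1.
have kN := NP k (fset1U1 _ _).
have sumP : \sum_a P A (z a) / chi a =
    (N ^ d)%:R * \sum_(m <- A | mod_congr N m k) c m * monomial u m.
  under eq_bigr do rewrite /P partial_sumE mulr_suml.
  rewrite exchange_big /= mulr_sumr [RHS]big_mkcond /=; apply: eq_bigr => m _.
  under eq_bigr do rewrite -mulrA.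
  rewrite -mulr_sumr sum_torus_monomial //.
  by case: ifP => _; rewrite ?mulr0 // mulrCA.
have sum_le : `|\sum_(m <- A | mod_congr N m k) c m * monomial u m| <= M + e / 2.
  have Nd_gt0 : 0 < (N ^ d)%:R :> Cplx R by rewrite ltr0n expn_gt0 N_gt0.
  rewrite -(ler_pM2l Nd_gt0) -{1}(ger0_norm (ltW Nd_gt0)) -normrM -sumP.
  rewrite (le_trans (ler_norm_sum _ _ _)) //.
  apply: (@le_trans _ _ (\sum_(a : {ffun 'I_d -> 'I_N}) (M + e / 2))); last first.
    by rewrite sumr_const card_ffun !card_ord mulr_natl.
  apply: ler_sum => a _.
  rewrite normf_div norm_character // divr1 -[P A _](subKr (f (z a))).
  rewrite (le_trans (ler_normB _ _)) // lerD ?(ltW (PA a)) //.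
  by apply: fM => j; rewrite norm_torus_point.
have tail_le :
    `|\sum_(m <- A | mod_congr N m k && (m != k)) c m * monomial u m| <= e / 2.
  apply: A0P => [|m mA0]; first exact: fsubset_trans (fsubsetU1 _ _) kA0A.
  by rewrite mod_congr_eq ?andbN // => j; apply: NP; rewrite fset1Ur.
(* Among the surviving terms, m = k is isolated; the others lie outside A0. *)
have -> : c k * monomial u k =
    \sum_(m <- A | mod_congr N m k) c m * monomial u m -
    \sum_(m <- A | mod_congr N m k && (m != k)) c m * monomial u m.
  rewrite (bigID (pred1 k)) /= addrK big_mkcond (bigD1_seq k) ?fset_uniq //=.
  rewrite mod_congr_eq // eqxx /= big1 ?addr0 // => m /negbTE->.
  by rewrite andbF.
rewrite (le_trans (ler_normB _ _)) //.
by rewrite (splitr e) addrA lerD.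
Unshelve. all: by end_near.
Qed.

(** * From the polydisc to the Young-Fenchel transform *)

Lemma norm_modulus (R : realType) (z : Cplx R) : `|z| = (modulus z)%:C%C.
Proof. by []. Qed.

Lemma expR_dotprod (R : realType) (d : nat) (v : 'rV[R]_d) (k : multi_index d) :
  expR (dotprod v (multi_index_vec R k)) = \prod_(j < d) expR (v 0 j) ^+ k j.
Proof. by rewrite expR_sum; apply: eq_bigr => j _; rewrite mxE expRM_natr. Qed.

(** Cauchy's inequality at the vertex u = e^v of the polydisc, where
    |u^k| = e^(v.k). *)
Lemma coef_le_max_modulus (R : realType) (d : nat)
    (c : multi_index d -> Cplx R) (f : 'rV[Cplx R]_d -> Cplx R)
    (v : 'rV[R]_d) (k : multi_index d) :
  entire_sum c f ->
  ((modulus (c k) * expR (dotprod v (multi_index_vec R k)))%:E <=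
     max_modulus f (map_mx (@expR R) v))%E.
Proof.
move=> hf; set r := map_mx _ v; pose u : 'rV[Cplx R]_d := \row_j (r 0 j)%:C%C.
have uE j : `|u 0 j| = (r 0 j)%:C%C.
  by rewrite mxE ger0_norm // lecR mxE expR_ge0.
have ub (z : 'rV[Cplx R]_d) : (forall j, `|z 0 j| = `|u 0 j|) ->
    ((modulus (f z))%:E <= max_modulus f r)%E.
  move=> zu; apply: ereal_sup_ubound; exists z => // j.
  by have := zu j; rewrite uE norm_modulus => -[->].
have := ub u (fun=> erefl).
case: (max_modulus f r) ub => [M| |] ub // _; last by rewrite leey.
rewrite lee_fin -lecR.
have -> : (modulus (c k) * expR (dotprod v (multi_index_vec R k)))%:C%C =
    `|c k * monomial u k|.
  rewrite normrM norm_monomial norm_modulus expR_dotprod rmorphM rmorph_prod.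
  congr (_ * _); apply: eq_bigr => j _.
  by rewrite uE rmorphXn mxE.
apply: cauchy_inequality hf _ => z /ub.
by rewrite norm_modulus lecR lee_fin.
Qed.

Theorem proposition4p1 (R : realType) (d : nat) (hd : (2 <= d)%N)
    (c : multi_index d -> Cplx R) (f : 'rV[Cplx R]_d -> Cplx R)
    (hf : entire_sum c f) (k : multi_index d) :
  ((modulus (c k))%:E <=
     expeR (- young_fenchel (log_max_modulus f) (multi_index_vec R k)))%E.
Proof.
have [c_le0|c_gt0] := leP (modulus (c k)) 0.
  by apply: le_trans (expeR_ge0 _); rewrite lee_fin.
rewrite -(lnK c_gt0) -[X in (X <= _)%E]/(expeR (ln (modulus (c k)))%:E).
rewrite lee_expeR leeNr; apply: ge_ereal_sup => _ [v _ <-].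
have := coef_le_max_modulus v k hf; rewrite /log_max_modulus.
have ce_gt0 := mulr_gt0 c_gt0 (expR_gt0 (dotprod v (multi_index_vec R k))).
(* An infinite M makes the term to bound -oo; a finite one is positive, so that
   its logarithm is the real one. *)
case: (max_modulus _ _) => [M| |] //; rewrite ?leNye // lee_fin => cM.
have M_gt0 := lt_le_trans ce_gt0 cM.
rewrite lne_EFin // lee_fin lerBlDl -lerBlDr opprK addrC.
by rewrite -[X in _ + X <= _]expRK -lnM ?posrE ?expR_gt0 // ler_ln ?posrE.
Qed.
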